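(* Let $a\in\mathbb{N}$, let $\mathcal{D}\subseteq\mathbb{R}^{a+1}$ be a bounded domain, and for $1\le j\le a$ let $f_j:\mathcal{D}\to\mathbb{R}$. Assume that for each $1\le j\le a$: $f_j$ is $L$-Lipschitz on $\mathcal{D}$, i.e. $|f_j(t,y_1,\ldots,y_a)-f_j(t',y_1',\ldots,y_a')|\le L\cdot\max\{|t-t'|,|y_1-y_1'|,\ldots,|y_a-y_a'|\}$, and $|f_j|\le B$ on $\mathcal{D}$. Given $(0,\tilde y_1,\ldots,\tilde y_a)\in\mathcal{D}$, assume that $y_1(t),\ldots,y_a(t)$ is the (unique) solution to the system $$y_j'(t)=f_j(t,y_1(t),\ldots,y_a(t)),\qquad y_j(0)=\tilde y_j,\qquad 1\le j\le a,$$ for all $t\in[0,\sigma]$, where $\sigma$ is a positive value. Suppose for each $1\le j\le a$ we have a sequence of random variables $(Y_j(i))_{i=0}^\infty$ which is adapted to the filtration $(\mathcal{H}_i)_{i=0}^\infty$. Let $n\in\mathbb{N}$, and let $\beta,b,\lambda,\delta>0$ be any parameters such that $\lambda\ge\frac{L+BL+\delta n}{3L}$. Moreover, assume that $\sigma>0$ is any value such that $(t,y_1(t),\ldots,y_a(t))$ has $\ell^\infty$-distance at least $3\lambda e^{2Lt}/n$ from the boundary of $\mathcal{D}$ for all $t\in[0,\sigma)$. Given an arbitrary stopping time $I\ge0$ adapted to $(\mathcal{H}_i)_{i=0}^\infty$, suppose that the following properties hold for each $0\le i<\min\{I,\sigma n\}$: 1. (Boundedness Hypothesis) $\max_j|\Delta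 Y_j(i)|\le\beta$ and $\max_j\mathbb{E}[(\Delta Y_j(i))^2\mid\mathcal{H}_i]\le b$. 2. (Trend Hypothesis) If $(i/n,Y_1(i)/n,\ldots,Y_a(i)/n)\in\mathcal{D}$, then $$\Big|\mathbb{E}[\Delta Y_j(i)\mid\mathcal{H}_i]-f_j(i/n,Y_1(i)/n,\ldots,Y_a(i)/n)\Big|\le\delta$$ for each $1\le j\le a$. 3. (Initial Condition) $|Y_j(0)-y_j(0)n|\le\lambda$ for all $1\le j\le a$. Then, with probability at least $1-2a\exp\left(-\frac{\lambda^2}{2(b\sigma n+2\beta\lambda)}\right)$, $$|Y_j(i)-n\,y_j(i/n)|\le3\lambda e^{2Li/n}$$ for all $1\le j\le a$ and $0\le i\le\min\{I,\sigma n\}$.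
   Context: For a sequence $(Y(i))_{i=0}^\infty$ of random variables, $\Delta Y(i):=Y(i+1)-Y(i)$; the index $i$ ranges over nonnegative integers. A filtration $(\mathcal{H}_i)_{i=0}^\infty$ is an increasing sequence of $\sigma$-algebras. A sequence $(Y(i))_{i=0}^\infty$ is adapted to $(\mathcal{H}_i)_{i=0}^\infty$ if $Y(i)$ is $\mathcal{H}_i$-measurable for each $i\ge0$. A stopping time $I$ is adapted to $(\mathcal{H}_i)_{i=0}^\infty$ if the event $\{I=i\}$ is $\mathcal{H}_i$-measurable for each $i\ge 0$. *)

(* Defs.v *)
From HB Require Import structures.
From mathcomp Require Import all_boot all_order all_algebra.
From mathcomp Require Import all_classical all_reals all_analysis.
From mathcomp Require Import measurable_realfun.

Set Implicit Arguments.
Unset Strict Implicit.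
Unset Printing Implicit Defensive.

Import Order.TTheory GRing.Theory Num.Theory.
Import numFieldNormedType.Exports.

Local Open Scope classical_set_scope.
Local Open Scope ring_scope.

Section Deterministic.
Context {R : realType}.

(* Limit of the difference quotient along [A]: at an endpoint of a closed
   interval [A] this is the one-sided derivative. *)
Definition has_derivative_within (A : set R) (g : R -> R) (t l : R) :=
  (fun s => (g s - g t) / (s - t)) @ within A t^' --> l.

Definition boundary {T : topologicalType} (A : set T) : set T :=
  closure A `\` interior A.

(* R^{a+1} is rendered as [R * 'rV[R]_a], whose library norm is
   max(|t|, max_j |y_j|), i.e. the l^infinity norm. *)
Definition domain {V : normedModType R} (D : set V) :=
  [/\ D !=set0, open D & connected D].

(* [f] is only constrained on [D]; its values outside [D] are junk, hence the
   explicit requirement that the graph of a solution stays in [D]. *)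
Definition ode_solution (a : nat) (D : set (R * 'rV[R]_a))
    (f : 'I_a -> R * 'rV[R]_a -> R) (y : 'I_a -> R -> R) (sigma : R) :=
  forall t, 0 <= t <= sigma ->
    D (t, \row_j y j t) /\
    forall j, has_derivative_within `[0, sigma] (y j) t (f j (t, \row_k y k t)).

End Deterministic.

Section Probability.
Context d (T : measurableType d) (R : realType) (P : probability T R).

Definition filtration (H : nat -> set (set T)) :=
  [/\ forall i, sigma_algebra setT (H i),
      forall i, H i `<=` measurable &
      forall i, H i `<=` H i.+1].

(* [<<s G >> = G] when [G] is a sigma-algebra. *)
Definition measurable_wrt {d'} {U : measurableType d'} (G : set (set T))
    (X : T -> U) :=
  measurable_fun [set: g_sigma_algebraType G] X.

Definition adapted (H : nat -> set (set T)) (Y : nat -> T -> R) :=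
  forall i, measurable_wrt (H i) (Y i).

(* [None] stands for the value +oo. *)
Definition stopping_time (H : nat -> set (set T)) (tau : T -> option nat) :=
  forall i, H i [set w | tau w = Some i].

Definition time_val (k : option nat) : \bar R :=
  if k is Some m then (m%:R)%:E else +oo%E.

Definition increment (Y : nat -> T -> R) (i : nat) : T -> R :=
  fun w => Y i.+1 w - Y i w.

Definition is_cond_exp_nneg (G : set (set T)) (X Z : T -> \bar R) :=
  [/\ forall w, (0 <= Z w)%E,
      measurable_wrt G Z &
      forall A, G A -> (\int[P]_(w in A) Z w = \int[P]_(w in A) X w)%E].

(* [Z] is a version of E[X | G], understood as E[X^+ | G] - E[X^- | G]. The two
   terms are extended-real valued and always exist, so no integrability of [X]
   is required; where both are +oo the difference is -oo by library convention.
   For integrable [X] this is the usual conditional expectation. *)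
Definition is_cond_exp (G : set (set T)) (X : T -> R) (Z : T -> \bar R) :=
  measurable_wrt G Z /\
  exists Zp Zn : T -> \bar R,
    [/\ is_cond_exp_nneg G ((EFin \o X)^\+)%E Zp,
        is_cond_exp_nneg G ((EFin \o X)^\-)%E Zn &
        {ae P, forall w, Z w = (Zp w - Zn w)%E}].

End Probability.

(* Main.v *)
Require Import Defs.
From HB Require Import structures.
From mathcomp Require Import all_boot all_order all_algebra.
From mathcomp Require Import all_classical all_reals all_analysis.
From mathcomp Require Import measurable_realfun.
From mathcomp Require Import ring lra.

Set Implicit Arguments.
Unset Strict Implicit.
Unset Printing Implicit Defensive.

Import Order.TTheory GRing.Theory Num.Theory.
Import numFieldNormedType.Exports.

Local Open Scope classical_set_scope.
Local Open Scope ring_scope.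

(** The scaled process [Y j i / n] follows a noisy Euler scheme of step [1 / n]
    for the differential system, and two independent facts bound its distance to
    the exact solution.

    Probability.  Write [e j k] for E[Delta Y_j(k) | H_k].  As long as the
    stopping time has not been reached, the sums of [X j k - e j k], with [X] the
    increments, form a martingale whose increments have bounded conditional
    second moment.  Freedman's inequality bounds by [expR (- lambda ^+ 2 / ...)]
    the probability that such a sum ever reaches [lambda] within the first
    [sigma * n] steps ([freedman_tail]); applied to both signs
    ([martingale_deviation]) and to the [a] coordinates ([union_bound]), it gives
    the announced failure probability.  The engine is the one-step estimate
    [exp_moment_step], which says that multiplying by
    [expR (theta * (X - e))] costs at most a constant factor in expectation; the
    factors multiply up along the filtration, and Markov's inequality concludes.
    The passage from conditional to plain expectations is the pull-out property
    [cond_exp_nneg_mul].  To bound a maximum over time rather than a final value,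
    the sum is frozen once it has reached [lambda] ([stopped_sum]).

    Determinism.  Off the bad event, [euler_path_close_to_ode] shows by induction
    on [i] that the error [E i] (the maximum over [j] of [|Y j i - n * y j (i / n)|])
    stays strictly below [3 * lambda * expR (2 * L * i / n)].  The strict bound
    and the distance of the solution to the boundary keep the path in [D]
    ([ball_off_boundary]), so that the trend hypothesis applies at every step.
    The error then splits into the initial error (at most [lambda]), the
    martingale part (below [lambda]), the drift and discretisation errors (at most
    [delta + L * (1 + B) / n] per step, see [euler_step_error], hence at most
    [3 * L * lambda * i / n] by the lower bound on [lambda]), and the Lipschitz
    term [L / n * \sum_(k < i) E k], summed by [sum_expR_le].  The last two
    are absorbed by [1 + x <= expR x], see [error_budget]. *)

(** * One-sided derivatives and the mean value theorem *)

Section det.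
Context {R : realType}.
Implicit Types (g : R -> R).

(** Multiplying out the difference quotient covers the point [s = t] as well,
    which the punctured filter excludes. *)
Lemma within_derivative_eps (A : set R) g t l e : has_derivative_within A g t l -> 0 < e ->
  exists2 d : R, 0 < d & forall s, A s -> `|s - t| < d ->
     `|g s - g t - l * (s - t)| <= e * `|s - t|.
Proof.
move=> /cvgrPdist_le /[apply]; rewrite near_withinE near_withinE.
move=> /nbhs_ballP[d /= d0 dP]; exists d => // s As sd.
have [->|st] := eqVneq s t; first by rewrite !subrr mulr0 subr0 !normr0 mulr0.
have := dP s; rewrite /ball /= distrC => /(_ sd st As).
have st' : s - t != 0 by rewrite subr_eq0.
have -> : g s - g t - l * (s - t) = - (l - (g s - g t) / (s - t)) * (s - t) by field.
by rewrite normrM normrN => h; rewrite ler_wpM2r.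
Qed.

Lemma within_derivative_cvg (A : set R) g t l : has_derivative_within A g t l ->
  g @ within A (nbhs t) --> g t.
Proof.
move=> h; apply/cvgrPdist_le => e e0.
have [d d0 dP] := within_derivative_eps h ltr01.
have K0 : 0 < 1 + `|l| by rewrite ltr_pwDl.
rewrite near_withinE; apply/nbhs_ballP; exists (Num.min d (e / (1 + `|l|))) => /=.
  by rewrite lt_min d0 divr_gt0.
move=> s; rewrite /ball /= lt_min => /andP[sd se] As; rewrite distrC in sd.
have := dP s As sd; rewrite mul1r => H.
rewrite distrC; have -> : g s - g t = (g s - g t - l * (s - t)) + l * (s - t) by ring.
apply: (le_trans (ler_normD _ _)); apply: (le_trans (lerD H (lexx _))).
rewrite normrM -[X in X + _]mul1r -mulrDl mulrC -ler_pdivlMr //.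
by rewrite distrC ltW.
Qed.

Lemma within_derivative_is_derive g a b t l : a < t < b ->
  has_derivative_within `[a, b] g t l -> is_derive t 1 g l.
Proof.
move=> /andP[at_ tb] h.
have H : h^-1 *: ((g \o shift t) (h *: 1) - g t) @[h --> 0^'] --> l.
  apply/cvgrPdist_le => e e0.
  have [d d0 dP] := within_derivative_eps h e0.
  apply/nbhs_ballP; exists (Num.min d (Num.min (t - a) (b - t))) => /=.
    by rewrite !lt_min d0 !subr_gt0 at_.
  move=> u; rewrite /ball /= sub0r normrN !lt_min => /and3P[ud ua ub] u0.
  have -> : u%:A + t = u + t by rewrite /GRing.scale /= mulr1.
  have := dP (u + t); rewrite addrK /=.
  have -> : `[a, b]%classic (u + t).
    rewrite /= in_itv /=; move: ua ub; rewrite !ltr_norml; lra.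
  move=> /(_ isT ud).
  have -> : l - u^-1 *: (g (u + t) - g t) = - u^-1 * (g (u + t) - g t - l * u).
    by rewrite /GRing.scale /=; field.
  move=> h1; rewrite normrM normrN normfV [X in X <= _]mulrC ler_pdivrMr //.
  by rewrite normr_gt0.
apply: DeriveDef; first by apply/cvg_ex; exists l.
exact: cvg_lim H.
Qed.

(** Endpoints of [`[a, b]] are allowed for [s] and [t]: the one-sided
    derivatives there still give continuity, and only interior points need a
    two-sided derivative. *)
Lemma within_derivative_mvt g dg a b s t : a <= s -> s < t -> t <= b ->
  (forall u, a <= u <= b -> has_derivative_within `[a, b] g u (dg u)) ->
  exists2 c, s < c < t & g t - g s = dg c * (t - s).
Proof.
move=> as_ st tb h.
have [u ub||c cst e] := @MVT _ g dg s t st.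
- apply: (@within_derivative_is_derive _ a b); first by move: ub; rewrite in_itv /=; lra.
  by apply: h; move: ub; rewrite in_itv /=; lra.
- apply: continuous_subspaceW (_ : {within `[a, b], continuous g}).
    by move=> u /=; rewrite !in_itv /=; lra.
  apply/subspace_continuousP => u; rewrite /= in_itv /= => ub.
  exact: within_derivative_cvg (h u ub).
- by exists c.
Qed.

(** * Euler error analysis *)

(** The segment from [p] to [q] is connected and avoids the boundary of [D], so
    its trace on [D], which is also its trace on [closure D], is both open and
    closed in it; containing [p], it is the whole segment. *)
Lemma ball_off_boundary (V : normedModType R) (D : set V) (p q : V) (r : R) :
  open D -> D p -> (forall z, boundary D z -> r <= `|p - z|) -> `|p - q| < r ->
  D q.
Proof.
move=> oD Dp far pq.
pose seg (s : R) := p + s *: (q - p).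
have seg_c : continuous seg.
  move=> s; apply: cvgD; first exact: cvg_cst.
  exact: scalel_continuous.
have segD : [set seg s | s in `[0, 1]] `&` D = [set seg s | s in `[0, 1]].
  have C := connected_continuous_connected (@segment_connected R 0 1)
              (continuous_subspaceT seg_c).
  apply: C.
  - by exists p; split=> //; exists 0; rewrite /= ?in_itv /= ?lexx ?ler01// /seg scale0r addr0.
  - by exists D.
  - exists (closure D); first exact: closed_closure.
    apply/seteqP; split=> z [[s]]; rewrite /= in_itv /= => /andP[s0 s1] <- Dz.
      split; last exact: subset_closure.
      by exists s; rewrite //= in_itv /= s0.
    split; first by exists s; rewrite //= in_itv /= s0.
    apply: contrapT => nD.
    have /far : boundary D (seg s).
      by split=> // /interior_subset.
    rewrite leNgt => /negP; apply; apply: le_lt_trans pq.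
    by rewrite /seg opprD addrA subrr sub0r normrN normrZ (ger0_norm s0) [leRHS]distrC ler_piMl.
have : [set seg s | s in `[0, 1]] q.
  by exists 1; rewrite /= ?in_itv /= ?lexx ?ler01// /seg scale1r addrC subrK.
by rewrite -segD => -[].
Qed.

Lemma row_norm_le a (u : 'I_a -> R) e : 0 <= e -> (forall j, `|u j| <= e) ->
  `|\row_j u j| <= e.
Proof.
move=> e0 h; rewrite [leLHS]mx_normrE; apply/bigmax_leP; split=> // -[i j] _ /=.
by rewrite mxE.
Qed.

Lemma row_norm_lt a (u : 'I_a -> R) e : 0 < e -> (forall j, `|u j| < e) ->
  `|\row_j u j| < e.
Proof.
move=> e0 h; rewrite [ltLHS]mx_normrE; apply/bigmax_ltP; split=> // -[i j] _ /=.
by rewrite mxE.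
Qed.

(** Each term is at most an increment of [expR], because
    [2 * h <= expR (2 * h) - 1]; the sum telescopes. *)
Lemma sum_expR_le (h : R) i : 0 <= h ->
  2 * h * \sum_(k < i) expR (2 * h * k%:R) <= expR (2 * h * i%:R) - 1.
Proof.
move=> h0; elim: i => [|i IH]; first by rewrite big_ord0 !mulr0 expR0 subrr.
rewrite big_ord_recr /= mulrDr.
have -> : 2 * h * i.+1%:R = 2 * h * i%:R + 2 * h by rewrite -natr1; ring.
rewrite expRD.
have := expR_ge1Dx (2 * h); have := expR_ge0 (2 * h * i%:R).
move: (expR _) (expR _) IH => x z; nra.
Qed.

(** Here [X] is the exponential factor [expR (2 * x)], [u] the initial error,
    [v] the martingale part, [w] the drift and discretisation errors and [s] the
    scaled geometric sum of [sum_expR_le]; the last hypothesis is [1 + 2 * x <= expR (2 * x)] scaled by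
    [l], and pays for the linear term [3 * l * x]. *)
Lemma error_budget (l u v w s x X : R) : 0 < l ->
  u <= l -> v < l -> w <= 3 * l * x -> l * s <= l * (X - 1) ->
  l * (1 + 2 * x) <= l * X -> u + v + (w + 3 / 2 * (l * s)) < 3 * l * X.
Proof. lra. Qed.

Section ode.
Variables (a : nat) (D : set (R * 'rV[R]_a)) (f : 'I_a -> R * 'rV[R]_a -> R) (L B : R).
Hypotheses (L0 : 0 < L) (hLip : forall j, L.-lipschitz_D (f j))
  (hB : forall j z, D z -> `|f j z| <= B).

Lemma lipschitz_le j t u t' u' e : D (t, \row_k u k) -> D (t', \row_k u' k) ->
  `|t - t'| <= e -> (forall k, `|u k - u' k| <= e) ->
  `|f j (t, \row_k u k) - f j (t', \row_k u' k)| <= L * e.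
Proof.
move=> D1 D2 te ue; apply: (le_trans (hLip j (conj D1 D2 : (D `*` D) (_, _)))) => /=.
rewrite ler_pM2l// prod_normE /= ge_max te /=.
have -> : \row_k u k - \row_k u' k = \row_k (u k - u' k).
  by apply/rowP => k; rewrite !mxE.
by apply: row_norm_le => //; apply: le_trans te.
Qed.

Variables (y : 'I_a -> R -> R) (sigma : R).
Hypothesis hode : ode_solution D f y sigma.

(** By the mean value theorem the increment is a slope at some intermediate time
    [c].  The slopes are bounded by [B], so between [s] and [c] the graph moves by
    at most [(1 + B) * (t - s)], and the slope itself by [L] times that. *)
Lemma euler_step_error j s t : 0 <= s -> s < t -> t <= sigma ->
  `|y j t - y j s - f j (s, \row_k y k s) * (t - s)| <= L * (1 + B) * (t - s) ^+ 2.
Proof.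
move=> s0 st ts.
have inD u : 0 <= u <= sigma -> D (u, \row_k y k u) by move=> /hode[].
have B0 : 0 <= B by apply: le_trans (hB j (inD s _)) => //; lra.
have incr i u v : 0 <= u -> u < v -> v <= sigma ->
    exists2 c, u < c < v & y i v - y i u = f i (c, \row_k y k c) * (v - u).
  move=> u0 uv vs.
  by apply: (@within_derivative_mvt _ (fun u => f i (u, \row_k y k u)) 0 sigma) => // w /hode[].
have [c /andP[sc ct] ->] := incr j s t s0 st ts.
rewrite -mulrBl normrM [`|t - s|]ger0_norm; last lra.
rewrite expr2 mulrA ler_pM2r; last lra.
rewrite -mulrA distrC; apply: lipschitz_le; [by apply: inD; lra..| |].
  rewrite distrC ger0_norm; nra.
move=> k; have [w sw e] := incr k s c s0 sc ltac:(lra).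
rewrite distrC e normrM [`|c - s|]ger0_norm; last lra.
have := hB k (inD w ltac:(lra)).
move: (`| _ |) (normr_ge0 (f k (w, \row_k y k w))) => x x0 xB.
nra.
Qed.

Variables (n : nat) (lambda delta : R).
Hypotheses (oD : open D) (n0 : (0 < n)%N) (lambda0 : 0 < lambda)
  (hlarge : (L + B * L + delta * n%:R) / (3 * L) <= lambda)
  (hdist : forall t : R, 0 <= t < sigma ->
     forall z : R * 'rV[R]_a, boundary D z ->
     3 * lambda * expR (2 * L * t) / n%:R <= `|(t, \row_j y j t) - z|).

(** A pathwise statement: [Y] is one trajectory, [e] its sequence of conditional
    drifts.  The trend is only assumed while the trajectory is in [D]; that it
    stays there is part of the induction, which is why the conclusion is strict
    although the boundary may be exactly at the allowed distance. *)
Lemma euler_path_close_to_ode (Y e : 'I_a -> nat -> R) (N : nat) :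
  N%:R <= sigma * n%:R ->
  (forall j, `|Y j 0%N - y j 0 * n%:R| <= lambda) ->
  (forall k, (k < N)%N -> D (k%:R / n%:R, \row_j (Y j k / n%:R)) -> forall j,
     `|e j k - f j (k%:R / n%:R, \row_j (Y j k / n%:R))| <= delta) ->
  (forall i j, (i <= N)%N -> `|\sum_(k < i) (Y j k.+1 - Y j k - e j k)| < lambda) ->
  forall i j, (i <= N)%N ->
    `|Y j i - n%:R * y j (i%:R / n%:R)| < 3 * lambda * expR (2 * L * i%:R / n%:R).
Proof.
move=> Nsig init trend mart.
have nR : 0 < n%:R :> R by rewrite ltr0n.
have nR0 : n%:R != 0 :> R by rewrite gt_eqF.
elim/ltn_ind => i IH j iN.
pose t (k : nat) : R := k%:R / n%:R.
have tsig k : (k <= i)%N -> 0 <= t k <= sigma.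
  move=> ki; rewrite /t divr_ge0 //= ler_pdivrMr //; apply: le_trans Nsig.
  by rewrite ler_nat (leq_trans ki).
have tS k : t k.+1 - t k = n%:R^-1 by rewrite /t -natr1 mulrDl mul1r addrAC subrr add0r.
have graph_in k : (k <= i)%N -> D (t k, \row_k0 y k0 (t k)) by move=> /tsig /hode[].
have nN (u v : R) : `|u - v / n%:R| * n%:R = `|v - n%:R * u|.
  have := normrM (u - v / n%:R) n%:R; rewrite normr_nat => <-.
  by rewrite mulrBl divfK // distrC [u * _]mulrC.
(* the induction hypothesis is strict, so the path cannot sit on the boundary *)
have inD k : (k < i)%N -> D (t k, \row_j (Y j k / n%:R)).
  move=> ki; apply: (ball_off_boundary oD (graph_in k (ltnW ki)) (hdist (t := t k) _)).
    have /andP[-> _] := tsig k (ltnW ki); rewrite /= ltr_pdivrMr //.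
    by apply: lt_le_trans Nsig; rewrite ltr_nat (leq_trans ki).
  rewrite prod_normE /= subrr normr0 gt_max divr_gt0 ?mulr_gt0 ?expR_gt0 //=.
  rewrite (_ : _ - _ = \row_j (y j (t k) - Y j k / n%:R)); last first.
    by apply/rowP => l; rewrite !mxE.
  apply: row_norm_lt => [|l]; first by rewrite divr_gt0 ?mulr_gt0 ?expR_gt0.
  have := IH k ki l (leq_trans (ltnW ki) iN).
  by rewrite ltr_pdivlMr // nN -[2 * L * _ / _]mulrA.
pose E k := Y j k.+1 - Y j k - e j k.
have step k : (k < i)%N ->
  `|e j k - n%:R * (y j (t k.+1) - y j (t k))| <=
     delta + L * (1 + B) / n%:R + L * (3 * lambda * expR (2 * (L / n%:R) * k%:R)) / n%:R.
  move=> ki.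
  set F := f j (t k, \row_j (Y j k / n%:R)).
  set G := f j (t k, \row_j y j (t k)).
  have -> : e j k - n%:R * (y j (t k.+1) - y j (t k)) =
     (e j k - F) + (F - G) + (G - n%:R * (y j (t k.+1) - y j (t k))) by ring.
  apply: (le_trans (ler_normD _ _)).
  rewrite [leRHS]addrAC; apply: lerD; last first.
    have /andP[tk0 _] := tsig k (ltnW ki); have /andP[_ tk1] := tsig k.+1 ki.
    have := euler_step_error j tk0 _ tk1.
    rewrite -subr_gt0 tS invr_gt0 nR => /(_ isT).
    rewrite -/G -nN => H.
    have -> : L * (1 + B) / n%:R = L * (1 + B) * n%:R^-1 ^+ 2 * n%:R by field.
    by rewrite ler_pM2r.
  apply: (le_trans (ler_normD _ _)); apply: lerD.
    by apply: trend; [exact: leq_trans iN | exact: inD].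
  rewrite -mulrA; apply: lipschitz_le.
  - exact: inD.
  - exact: graph_in (ltnW ki).
  - by rewrite subrr normr0 divr_ge0 ?mulr_ge0 ?expR_ge0 // ltW.
  move=> l; rewrite distrC ler_pdivlMr // nN.
  apply: ltW; apply: lt_le_trans (IH k ki l (leq_trans (ltnW ki) iN)) _.
  by rewrite (_ : 2 * (L / n%:R) * k%:R = 2 * L * k%:R / n%:R) //; ring.
(* a telescoping sum, with the conditional drift added and subtracted *)
have decomp : Y j i - n%:R * y j (t i) = (Y j 0%N - y j 0 * n%:R) + \sum_(k < i) E k
   + \sum_(k < i) (e j k - n%:R * (y j (t k.+1) - y j (t k))).
  rewrite -addrA -big_split /=.
  pose u k := Y j k - n%:R * y j (t k).
  rewrite (eq_bigr (fun k : 'I_i => u k.+1 - u k)).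
    rewrite -(big_mkord predT (fun k => u k.+1 - u k)).
    by rewrite telescope_sumr // /u /t mul0r; ring.
  by move=> k _; rewrite /E /u; ring.
rewrite -/(t i) decomp.
have M := mart i j iN.
have S1 : `|\sum_(k < i) (e j k - n%:R * (y j (t k.+1) - y j (t k)))| <=
   i%:R * (delta + L * (1 + B) / n%:R)
   + L * (3 * lambda) / n%:R * \sum_(k < i) expR (2 * (L / n%:R) * k%:R).
  apply: (le_trans (ler_norm_sum _ _ _)); rewrite mulr_sumr.
  rewrite (_ : i%:R * _ = \sum_(k < i) (delta + L * (1 + B) / n%:R)); last first.
    by rewrite sumr_const card_ord mulr_natl.
  rewrite -big_split /=; apply: ler_sum => k _; apply: le_trans (step k (ltn_ord k)) _.
  rewrite lerD2l le_eqVlt; apply/orP; left; apply/eqP; ring.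
have Ln0 : 0 <= L / n%:R by rewrite divr_ge0 // ltW.
have S2 := sum_expR_le i Ln0.
have -> : 2 * L * i%:R / n%:R = 2 * (L / n%:R) * i%:R by ring.
have S3 := expR_ge1Dx (2 * (L / n%:R) * i%:R).
set X := expR _ in S2 S3 *.
have S4 : i%:R * (delta + L * (1 + B) / n%:R) <= 3 * lambda * (L / n%:R * i%:R).
  have -> : i%:R * (delta + L * (1 + B) / n%:R) =
    (L + B * L + delta * n%:R) * (i%:R / n%:R) by field.
  have -> : 3 * lambda * (L / n%:R * i%:R) = (3 * L * lambda) * (i%:R / n%:R) by ring.
  apply: ler_wpM2r; first by rewrite divr_ge0.
  by move: hlarge; rewrite ler_pdivrMr ?mulr_gt0 // [lambda * _]mulrC.
have I0 := init j.
apply: (le_lt_trans (ler_normD _ _)); apply: (le_lt_trans (lerD (ler_normD _ _) S1)).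
set S := \sum_(k < i) expR _ in S1 S2 *.
have -> : L * (3 * lambda) / n%:R * S = (3 / 2) * (lambda * (2 * (L / n%:R) * S)) by field.
rewrite -[2 * _ * i%:R]mulrA in S3.
have h6 : lambda * (2 * (L / n%:R) * S) <= lambda * (X - 1) by rewrite ler_pM2l.
have h7 : lambda * (1 + 2 * (L / n%:R * i%:R)) <= lambda * X by rewrite ler_pM2l.
exact: error_budget h6 h7.
Qed.

End ode.
End det.

(** * A quadratic bound on the exponential *)

Section expo.
Context {R : realType}.

(** The second-order term must keep a constant tending to [1 / 2] as [c] tends
    to [0]: it becomes the variance term of the tail bound.  For [0 <= u] the
    claim with [c := u] amounts to [2 * (1 - u) * expR u <= 2 - u ^+ 2], and the
    right side minus the left has derivative [2 * u * (expR u - 1)]; for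
    [u < 0] even the plain second-order Taylor polynomial is an upper bound. *)
Lemma expR_le_quadratic (c u : R) : `|u| <= c -> c < 1 ->
  expR u <= 1 + u + u ^+ 2 / (2 * (1 - c)).
Proof.
move=> uc c1; have c0 : 0 <= c by apply: le_trans uc.
have [u0|u0] := leP 0 u.
  have uc' : u <= c by rewrite -(ger0_norm u0).
  pose g (x : R) := 2 - x ^+ 2 - 2 * (1 - x) * expR x.
  have dg (x : R) : is_derive x 1 g (2 * x * (expR x - 1)).
    rewrite /g; apply: is_derive_eq; rewrite /GRing.scale /= ; ring.
  have [x xu e] := MVT_segment u0 (fun x _ => dg x)
     (derivable_within_continuous (fun x _ => @ex_derive _ _ _ _ _ _ _ (dg x))).
  have gu : 0 <= g u.
    have g0 : g 0 = 0 by rewrite /g expR0; ring.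
    move: e; rewrite g0 !subr0 => ->; move: xu; rewrite in_itv /= => /andP[x0 _].
    rewrite !mulr_ge0 // subr_ge0; apply: le_trans (expR_ge1Dx x); lra.
  have h1 : expR u <= 1 + u + u ^+ 2 / (2 * (1 - u)).
    have -> : 1 + u + u ^+ 2 / (2 * (1 - u)) = (2 - u ^+ 2) / (2 * (1 - u)).
      by field; rewrite gt_eqF //; lra.
    rewrite ler_pdivlMr; last lra.
    by move: gu; rewrite /g; lra.
  apply: (le_trans h1); rewrite lerD2l ler_wpM2l ?sqr_ge0 // lef_pV2 ?posrE; lra.
pose h (x : R) := expR x - 1 - x - x ^+ 2 / 2.
have dh (x : R) : is_derive x 1 h (expR x - 1 - x).
  by rewrite /h; apply: is_derive_eq; rewrite /GRing.scale /=; field.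
have [x xu e] := MVT_segment (ltW u0) (fun x _ => dh x)
     (derivable_within_continuous (fun x _ => @ex_derive _ _ _ _ _ _ _ (dh x))).
have h0 : h 0 = 0 by rewrite /h expR0; field.
have hu : h u <= 0.
  have -> : h u = (expR x - 1 - x) * u by move: e; rewrite h0; lra.
  rewrite nmulr_lle0 //; have := expR_ge1Dx x; lra.
have h1 : expR u <= 1 + u + u ^+ 2 / 2 by move: hu; rewrite /h; lra.
apply: (le_trans h1); rewrite lerD2l ler_wpM2l ?sqr_ge0 // lef_pV2 ?posrE; lra.
Qed.
End expo.

(** * Conditional expectations *)

Section condexp.
Context d (T : measurableType d) (R : realType) (P : probability T R).
Variable (G : set (set T)).
Hypotheses (sG : sigma_algebra setT G) (GM : G `<=` measurable).

Lemma measurable_g_sigma_algebra (A : set T) :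
  (measurable (A : set (g_sigma_algebraType G))) = G A.
Proof. by rewrite /measurable /= sigma_algebra_id. Qed.

Lemma measurable_wrt_sub d' (U : measurableType d') (X : T -> U) :
  measurable_wrt G X -> measurable_fun setT X.
Proof.
move=> mX _ B mB; have := mX measurableT B mB.
by rewrite measurable_g_sigma_algebra => /GM.
Qed.

Local Open Scope ereal_scope.
Import HBNNSimple.

Lemma integral_nnsfun_mul (g : {nnsfun (g_sigma_algebraType G) >-> R}) (A : set T) (X : T -> \bar R) :
  measurable A -> measurable_fun setT X -> (forall w, 0 <= X w) ->
  \int[P]_(w in A) ((g w)%:E * X w) =
  \sum_(k \in range g) k%:E * \int[P]_(w in g @^-1` [set k] `&` A) X w.
Proof.
move=> mA mX X0.
have mg k : (measurable (g @^-1` [set k] : set T)).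
  have : measurable (g @^-1` [set k] : set (g_sigma_algebraType G)) by exact: measurable_sfunP.
  by rewrite measurable_g_sigma_algebra => /GM.
have mi k : measurable_fun A (fun w => (k * \1_(g @^-1` [set k]) w)%:E).
  by apply/measurable_EFinP; apply: measurable_funM => //; exact: measurable_indic.
transitivity (\int[P]_(w in A) (\sum_(y \in range g)
    (y * \1_(g @^-1` [set y]) w)%:E * X w)).
  apply: eq_integral => x xE.
  rewrite -ge0_mule_fsuml => [|y]; last exact: nnfun_muleindic_ge0.
  by congr (_ * _); rewrite fsumEFin //; congr EFin; exact: fimfunE.
rewrite ge0_integral_fsum//; last 2 first.
  - by move=> y; apply: emeasurable_funM => //; exact: measurable_funTS.
  - by move=> m y Ey; rewrite mule_ge0 // nnfun_muleindic_ge0.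
apply: eq_fsbigr => r rhn.
under eq_integral do rewrite EFinM -muleA.
rewrite ge0_integralZl//.
- congr (_ * _); rewrite [RHS]integral_mkcondl; apply: eq_integral => x _.
  by rewrite epatch_indic muleC.
- apply: emeasurable_funM; last exact: measurable_funTS.
  by apply/measurable_EFinP; exact: measurable_indic.
- by move=> t Et; rewrite mule_ge0 ?lee_fin.
- by move: rhn; rewrite inE => -[t _ <-]; rewrite lee_fin.
Qed.

(** The pull-out property: a [G]-measurable factor [V] may be moved across the
    conditional expectation.  For simple [V] it is the definition, on each level
    set; the general case follows by monotone convergence.  Nonnegativity
    makes both sides meaningful even where [Z] takes the value [+oo]. *)
Lemma cond_exp_nneg_mul (X Z : T -> \bar R) (V : T -> R) (A : set T) :
  is_cond_exp_nneg P G X Z -> measurable_fun setT X -> (forall w, 0 <= X w) ->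
  measurable_wrt G V -> (forall w, (0 <= V w)%R) -> G A ->
  \int[P]_(w in A) ((V w)%:E * Z w) = \int[P]_(w in A) ((V w)%:E * X w).
Proof.
move=> [Z0 mZ ZX] mX X0 mV V0 GA.
have mA := GM GA.
have mAG : measurable (A : set (g_sigma_algebraType G)) by rewrite measurable_g_sigma_algebra.
have mVA : measurable_fun (A : set (g_sigma_algebraType G)) (EFin \o V).
  by apply/measurable_EFinP; apply: measurable_funTS mV.
pose h := nnsfun_approx mAG mVA.
have ndh m n w : (m <= n)%N -> (h m w <= h n w)%R.
  by move=> mn; have /lefP := nd_nnsfun_approx mAG mVA mn; exact.
have hE (U : T -> \bar R) : measurable_fun setT U -> (forall w, 0 <= U w) ->
   \int[P]_(w in A) ((V w)%:E * U w) =
    lim (\int[P]_(w in A) ((h n w)%:E * U w) @[n --> \oo]).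
  move=> mU U0.
  have fg w : A w -> (V w)%:E * U w = lim ((h n w)%:E * U w @[n --> \oo]).
    move=> Aw; apply/esym/cvg_lim => //.
    have hV : EFin \o h^~ w @ \oo --> (V w)%:E.
      by apply: (@cvg_nnsfun_approx _ _ _ _ mAG _ mVA _ w Aw) => x _; rewrite lee_fin.
    (* where [V] vanishes so do all its approximations, which settles [0 * +oo] *)
    have [V00|VN0] := eqVneq (V w) 0%R.
      suff h0 n : h n w = 0%R.
        under eq_fun do rewrite h0 mul0e; rewrite V00 mul0e; exact: cvg_cst.
      apply/eqP; rewrite eq_le (_ : (0 <= h n w)%R) // andbT.
      rewrite -lee_fin -V00 -(cvg_lim _ hV) //.
      have nd : nondecreasing_seq (EFin \o h^~ w).
        by move=> a b ab /=; rewrite lee_fin; exact: ndh.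
      by rewrite (cvg_lim _ (ereal_nondecreasing_cvgn nd)) //; apply: ereal_sup_ubound; exists n.
    apply: cvgeM => //; last exact: cvg_cst.
    by case: (U w) => [r||]; rewrite /mule_def /=.
  under eq_integral => w /[!inE] /fg -> //.
  apply: monotone_convergence => //.
  - move=> n; apply: emeasurable_funM; last exact: measurable_funTS.
    apply/measurable_EFinP/measurable_funTS/measurable_wrt_sub.
    exact: measurable_funP.
  - by move=> n x Ex /=; rewrite mule_ge0 ?lee_fin.
  - by move=> x Ex a b ab/=; rewrite lee_wpmul2r ?lee_fin //; exact: ndh.
rewrite !hE //; last exact: measurable_wrt_sub.
congr (lim _); apply/funext => n.
suff E : (fun n => \int[P]_(w in A) ((h n w)%:E * Z w)) =
         (fun n => \int[P]_(w in A) ((h n w)%:E * X w)) by rewrite E.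
apply/funext => m; rewrite !integral_nnsfun_mul //; last exact: measurable_wrt_sub.
apply: eq_fsbigr => k _; rewrite ZX //.
rewrite -measurable_g_sigma_algebra; apply: measurableI => //; exact: measurable_sfunP.
Qed.

End condexp.

Section moments.
Context d (T : measurableType d) (R : realType) (P : probability T R).
Variable (G : set (set T)).
Hypotheses (sG : sigma_algebra setT G) (GM : G `<=` measurable).
Local Open Scope ereal_scope.

(** On the set [S] where [Z] exceeds [c] inside [A], the integral of [Z - c > 0]
    is at most that of [X - c <= 0], so [S] is negligible. *)
Lemma cond_exp_nneg_le (X Z : T -> \bar R) (c : R) (A : set T) :
  is_cond_exp_nneg P G X Z -> measurable_fun setT X -> (forall w, 0 <= X w) ->
  (0 <= c)%R -> G A -> {ae P, forall w, A w -> X w <= c%:E} ->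
  {ae P, forall w, A w -> Z w <= c%:E}.
Proof.
move=> [Z0 mZ ZX] mX X0 c0 GA Xc.
have mZT := measurable_wrt_sub sG GM mZ.
pose S : set T := A `&` [set w | c%:E < Z w].
have GS : G S.
  rewrite -(measurable_g_sigma_algebra sG); apply: measurableI.
    by rewrite measurable_g_sigma_algebra.
  rewrite -[X in measurable X]setTI.
  exact: (@emeasurable_fun_o_infty _ (g_sigma_algebraType G) R setT Z measurableT mZ).
have mS := GM GS.
pose f w := Z w - c%:E.
have f0 w : S w -> 0 <= f w by move=> [_ /= cZ]; rewrite sube_ge0 // ltW.
have mf : measurable_fun S f by apply: emeasurable_funB => //; apply: measurable_funTS.
have int0 : \int[P]_(w in S) f w = 0.
  have le : \int[P]_(w in S) f w + c%:E * P S <= 0 + c%:E * P S.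
    rewrite add0e -integral_cst // -ge0_integralD //.
    have -> : \int[P]_(w in S) (f w + c%:E) = \int[P]_(w in S) Z w.
      by apply: eq_integral => w _; rewrite /f subeK.
    rewrite ZX //; apply: ae_ge0_le_integral => //.
    - exact: measurable_funTS.
    - by apply: filterS Xc => w h [Aw _]; exact: h.
  move: le; rewrite leeD2rE; last by rewrite fin_numM // fin_num_measure.
  by move=> le; apply/eqP; rewrite eq_le le integral_ge0.
have : ae_eq P S f (cst 0).
  apply/(ae_eq_integral_abs _ mS mf); rewrite -[RHS]int0.
  by apply: eq_integral => w /[!inE] Sw; rewrite gee0_abs // f0.
apply: filterS => w h Aw; rewrite leNgt; apply/negP => cZ.
have := h (conj Aw cZ); rewrite /f /=; case: (Z w) cZ => [r| |] //.
by rewrite lte_fin => cr [] /eqP; rewrite subr_eq0 => /eqP rc; rewrite rc ltxx in cr.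
Qed.

(** The increment [X] is not centred before the exponential is expanded: the
    factor [expR (- theta * e)] is [G]-measurable and goes into the weight
    [V], so [expR_le_quadratic] is used under the bound [beta] on [X] itself
    (centring would double it) and the bound [b] on the raw second moment appears
    directly.  Let [phi] be [1 / (2 * (1 - theta * beta))].
    Taking conditional expectations turns [1 + theta * X + phi * theta ^+ 2 * X ^+ 2]
    into at most [1 + theta * e + phi * theta ^+ 2 * b], which is at most the
    exponential of [theta * e + phi * theta ^+ 2 * b], and [V] cancels
    [expR (theta * e)].
    To use the nonnegative pull-out property, [X] is split into [X^+ - X^-], the
    negative part being carried on the other side of the inequality and
    cancelled at the end, its integral [Jn] being finite. *)
Lemma exp_moment_step (X e W : T -> R) (Zp Zn Z2 : T -> \bar R)
    (beta b theta : R) (A : set T) :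
  (0 < b)%R -> (0 <= theta)%R -> (0 < beta)%R -> (theta * beta < 1)%R ->
  measurable_fun setT X -> measurable_wrt G e -> measurable_wrt G W ->
  (forall w, (0 <= W w)%R) -> (forall w, (`|e w| <= beta)%R) -> G A ->
  is_cond_exp_nneg P G (EFin \o X)^\+ Zp ->
  is_cond_exp_nneg P G (EFin \o X)^\- Zn ->
  is_cond_exp_nneg P G (EFin \o (fun w => X w ^+ 2)%R) Z2 ->
  {ae P, forall w, A w -> (`|X w| <= beta)%R} ->
  {ae P, forall w, A w -> Zp w = (e w)%:E + Zn w} ->
  {ae P, forall w, A w -> Z2 w <= b%:E} ->
  \int[P]_(w in A) (W w)%:E < +oo ->
  \int[P]_(w in A) (W w * expR (theta * (X w - e w)))%:E <=
  (expR (theta ^+ 2 * b / (2 * (1 - theta * beta))))%:E * \int[P]_(w in A) (W w)%:E.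
Proof.
move=> b0 th0 beta0 tb1 mX me mW W0 ebeta GA hZp hZn hZ2 Xbeta Zpn Z2b Wfin.
have mA := GM GA.
pose phi : R := ((2 * (1 - theta * beta))^-1)%R.
have phi0 : (0 <= phi)%R by rewrite invr_ge0; lra.
pose V w := (W w * expR (- (theta * e w)))%R.
have V0 w : (0 <= V w)%R by rewrite mulr_ge0 ?expR_ge0.
have mV : measurable_wrt G V.
  apply: measurable_funM => //; apply: measurableT_comp => //.
  by apply: measurable_funN; apply: measurable_funM.
have mscale k : measurable_wrt G (fun w => k * V w)%R by apply: measurable_funM.
have scale0 k w : (0 <= k)%R -> (0 <= k * V w)%R by move=> k0; rewrite mulr_ge0.
have sub (U : T -> R) : measurable_wrt G U -> measurable_fun A (EFin \o U).
  by move=> mU; apply/measurable_EFinP; apply: measurable_funTS; exact: measurable_wrt_sub mU.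
have subE (U : T -> \bar R) : measurable_wrt G U -> measurable_fun A U.
  by move=> mU; apply: measurable_funTS; exact: measurable_wrt_sub mU.
have mXp : measurable_fun setT (EFin \o X)^\+ by apply/measurable_funepos/measurable_EFinP.
have mXn : measurable_fun setT (EFin \o X)^\- by apply/measurable_funeneg/measurable_EFinP.
have mX2 : measurable_fun setT (EFin \o (fun w => X w ^+ 2)%R).
  by apply/measurable_EFinP; exact: measurable_funX.
have th2 : (0 <= phi * theta ^+ 2)%R by rewrite mulr_ge0 // sqr_ge0.
have [Zp0 mZp _] := hZp; have [Zn0 mZn _] := hZn; have [Z20 mZ2 _] := hZ2.
have pull_p := cond_exp_nneg_mul sG GM hZp mXp (funepos_ge0 _) (mscale theta) (fun w => scale0 _ w th0) GA.
have pull_n := cond_exp_nneg_mul sG GM hZn mXn (funeneg_ge0 _) (mscale theta) (fun w => scale0 _ w th0) GA.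
have X20 w : 0 <= (EFin \o (fun w => X w ^+ 2)%R) w by rewrite lee_fin sqr_ge0.
have pull_2 := cond_exp_nneg_mul sG GM hZ2 mX2 X20 (mscale _) (fun w => scale0 _ w th2) GA.
have Xn_le : {ae P, forall w, A w -> (EFin \o X)^\- w <= beta%:E}.
  apply: filterS Xbeta => w h Aw; have := h Aw.
  rewrite funenegE /= ge_max !lee_fin => hw; apply/andP; split; last exact: ltW.
  by move: hw; rewrite ler_norml; lra.
have Zn_le := cond_exp_nneg_le hZn mXn (funeneg_ge0 _) (ltW beta0) GA Xn_le.
set Jn := \int[P]_(w in A) ((theta * V w)%:E * Zn w).
have Jn_fin : Jn \is a fin_num.
  rewrite ge0_fin_numE; last by apply: integral_ge0 => w _; rewrite mule_ge0 // lee_fin scale0.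
  have K0 : (0 <= theta * expR (theta * beta) * beta)%R by rewrite !mulr_ge0 ?expR_ge0 // ltW.
  apply: (@le_lt_trans _ _
    (\int[P]_(w in A) ((theta * expR (theta * beta) * beta)%:E * (W w)%:E))); last first.
    by rewrite ge0_integralZl_EFin // ?lte_mul_pinfty //; [move=> w _; rewrite lee_fin|exact: sub].
  apply: ae_ge0_le_integral => //.
  - by move=> w _; rewrite mule_ge0 // lee_fin scale0.
  - by apply: emeasurable_funM; [exact: sub|exact: subE].
  - by move=> w _; rewrite -EFinM lee_fin mulr_ge0.
  - by apply: emeasurable_funM => //; exact: sub.
  apply: filterS Zn_le => w h Aw; have := h Aw; move: (Zn0 w).
  case: (Zn w) => // r; rewrite -!EFinM !lee_fin => r0 rb.
  apply: (@le_trans _ _ (theta * V w * beta)%R); first by rewrite ler_wpM2l // scale0.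
  rewrite (_ : (theta * expR (theta * beta) * beta * W w =
    theta * (W w * expR (theta * beta)) * beta)%R); last by ring.
  rewrite ler_wpM2r ?(ltW beta0) // ler_wpM2l // ler_wpM2l // ler_expR -mulrN ler_wpM2l //.
  by have := ebeta w; rewrite ler_norml; lra.
rewrite -(leeD2rE _ _ Jn_fin).
have mexp : measurable_fun A (fun w => (V w * expR (theta * X w))%:E).
  apply/measurable_EFinP; apply: measurable_funM.
    by apply: measurable_funTS; exact: measurable_wrt_sub mV.
  by apply: measurable_funTS; apply: measurableT_comp => //; apply: measurable_funM.
have -> : \int[P]_(w in A) (W w * expR (theta * (X w - e w)))%:E =
          \int[P]_(w in A) (V w * expR (theta * X w))%:E.
  by apply: eq_integral => w _; rewrite /V mulrBr expRD; congr EFin; ring.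
rewrite /Jn pull_n -ge0_integralD //; last 3 first.
- by move=> w _; rewrite lee_fin mulr_ge0 // expR_ge0.
- by move=> w _; rewrite mule_ge0 ?funeneg_ge0 // lee_fin scale0.
- by apply: emeasurable_funM; [exact: sub|exact: measurable_funTS].
have mpull (U : T -> \bar R) k : measurable_fun setT U ->
    measurable_fun A (fun w => (k * V w)%:E * U w).
  by move=> mU; apply: emeasurable_funM; [exact: sub|exact: measurable_funTS].
have pull0 (U : T -> \bar R) k : (0 <= k)%R -> (forall w, 0 <= U w) ->
    forall w, A w -> 0 <= (k * V w)%:E * U w.
  by move=> k0 U0 w _; rewrite mule_ge0 // lee_fin scale0.
apply: (@le_trans _ _ (\int[P]_(w in A) ((V w)%:E + ((theta * V w)%:E * (EFin \o X)^\+ w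
   + (phi * theta ^+ 2 * V w)%:E * (EFin \o (fun w => X w ^+ 2)%R) w)))).
  apply: ae_ge0_le_integral => //.
  - move=> w Aw; apply: adde_ge0; first by rewrite lee_fin mulr_ge0 // expR_ge0.
    by apply: pull0 => // v; exact: funeneg_ge0.
  - by apply: emeasurable_funD => //; exact: mpull.
  - move=> w Aw; apply: adde_ge0; first by rewrite lee_fin.
    by apply: adde_ge0; apply: pull0 => // v; exact: funepos_ge0.
  - by apply: emeasurable_funD; [exact: sub|apply: emeasurable_funD; exact: mpull].
  apply: filterS Xbeta => w h Aw; have Xb := h Aw.
  rewrite funeposE funenegE /= -!EFin_max -!EFinM -!EFinD lee_fin.
  have tX : (`|theta * X w| <= theta * beta)%R by rewrite normrM ger0_norm // ler_wpM2l.
  have := ler_wpM2l (V0 w) (expR_le_quadratic tX tb1).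
  have -> : (Num.max (X w) 0 = X w + Num.max (- X w) 0)%R.
    by rewrite /Num.max; case: ltP => ?; case: ltP => ?; lra.
  rewrite exprMn -/phi; lra.
rewrite ge0_integralD //; last 4 first.
- by move=> w _; rewrite lee_fin.
- exact: sub.
- by move=> w Aw; apply: adde_ge0; apply: pull0 => // v; exact: funepos_ge0.
- by apply: emeasurable_funD; exact: mpull.
rewrite ge0_integralD //; last 4 first.
- by apply: pull0 => //; exact: funepos_ge0.
- exact: mpull.
- by apply: pull0.
- exact: mpull.
rewrite -pull_p -pull_2 -pull_n.
rewrite -ge0_integralD //; last 4 first.
- exact: pull0.
- by apply: emeasurable_funM; [exact: sub|exact: subE].
- exact: pull0.
- by apply: emeasurable_funM; [exact: sub|exact: subE].
rewrite -ge0_integralD //; last 4 first.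
- by move=> w _; rewrite lee_fin.
- exact: sub.
- by move=> w Aw; apply: adde_ge0; exact: pull0.
- by apply: emeasurable_funD; apply: emeasurable_funM; [exact: sub|exact: subE|exact: sub|exact: subE].
rewrite -ge0_integralZl_EFin //; last 2 first.
- by move=> w _; rewrite lee_fin.
- exact: sub.
rewrite -ge0_integralD //; last 4 first.
- by move=> w _; rewrite -EFinM lee_fin mulr_ge0 // expR_ge0.
- by apply: emeasurable_funM => //; exact: sub.
- exact: pull0.
- by apply: emeasurable_funM; [exact: sub|exact: subE].
apply: ae_ge0_le_integral => //.
- move=> w Aw; apply: adde_ge0; first by rewrite lee_fin.
  by apply: adde_ge0; exact: pull0.
- apply: emeasurable_funD; first exact: sub.
  by apply: emeasurable_funD; apply: emeasurable_funM; [exact: sub|exact: subE|exact: sub|exact: subE].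
- move=> w Aw; apply: adde_ge0; last exact: pull0.
  by rewrite -EFinM lee_fin mulr_ge0 // expR_ge0.
- apply: emeasurable_funD; apply: emeasurable_funM => //; [exact: sub|exact: sub|exact: subE].
apply: filterS3 Zpn Z2b Zn_le => w h1 h2 h3 Aw.
rewrite h1 //; move: (Zn0 w) (h3 Aw) (Z20 w) (h2 Aw).
case: (Zn w) => // r; case: (Z2 w) => // r2; rewrite -EFinD -!EFinM.
rewrite -!EFinD !lee_fin => r0 rb r20 r2b.
rewrite [X in (_ <= X * _ + _)%R](_ : _ = expR (phi * theta ^+ 2 * b)); last first.
  by congr expR; rewrite /phi; field; lra.
have := expR_ge1Dx (theta * e w + phi * theta ^+ 2 * b).
have e1 := ler_wpM2l th2 r2b.
have -> : (expR (phi * theta ^+ 2 * b) * W w = V w * expR (theta * e w + phi * theta ^+ 2 * b))%R.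
  by rewrite /V expRD mulrA -[(W w * _ * _)%R]mulrA -expRD addNr expR0; ring.
move=> e2; have := ler_wpM2l (V0 w) e2; have := ler_wpM2l (V0 w) e1; lra.
Qed.

End moments.

(** * Freedman's inequality *)

Section freedman.
Context d (T : measurableType d) (R : realType) (P : probability T R).

(** The partial sums of [D] over the times in [A], frozen as soon as they reach
    [lambda]: the maximal inequality then follows from a bound on the last one. *)
Fixpoint stopped_sum (lambda : R) (A : nat -> set T) (D : nat -> T -> R) (i : nat) : T -> R :=
  if i is k.+1 then fun w => stopped_sum lambda A D k w +
    \1_(A k `&` [set v | stopped_sum lambda A D k v < lambda]) w * D k w
  else cst 0.

(** If the frozen sum ends below [lambda], it was never frozen, so as long as all
    times are in [A] it is the plain sum, which therefore stays below [lambda]. *)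
Lemma stopped_sum_lt lambda A D N w : stopped_sum lambda A D N w < lambda ->
  forall i, (i <= N)%N -> (forall k, (k < i)%N -> A k w) ->
  \sum_(k < i) D k w < lambda.
Proof.
move=> SN; have Slt i : (i <= N)%N -> stopped_sum lambda A D i w < lambda.
  elim: N SN i => [|N IH] SN i; first by rewrite leqn0 => /eqP ->.
  rewrite leq_eqVlt => /predU1P[->//|iN]; apply: IH => //.
  rewrite ltNge; apply/negP => le; move: SN => /=; rewrite indicE memNset; last first.
    by move=> [_ /=]; rewrite ltNge le.
  by rewrite mul0r addr0 ltNge le.
suff eqS i : (i <= N)%N -> (forall k, (k < i)%N -> A k w) ->
    \sum_(k < i) D k w = stopped_sum lambda A D i w.
  by move=> i iN Ai; rewrite eqS //; exact: Slt.
elim: i => [|i IH] iN Ai; first by rewrite big_ord0.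
rewrite big_ord_recr /= IH ?(ltnW iN)//; last by move=> k ki; apply: Ai; exact: ltnW.
rewrite indicE mem_set ?mul1r //; split; first exact: Ai.
exact: Slt (ltnW iN).
Qed.

Variable (H : nat -> set (set T)).
Hypothesis hH : filtration H.

Lemma filtration_le i j : (i <= j)%N -> H i `<=` H j.
Proof.
have [_ _ h] := hH; move=> /subnK <-; elim: (j - i)%N => // k IH.
by rewrite addSn; apply: subset_trans (h _).
Qed.

Lemma filtration_sigma i : sigma_algebra setT (H i). Proof. by have [] := hH. Qed.
Lemma filtration_measurable i : H i `<=` measurable. Proof. by have [] := hH. Qed.

Lemma measurable_wrt_le d' (U : measurableType d') i j (X : T -> U) :
  (i <= j)%N -> measurable_wrt (H i) X -> measurable_wrt (H j) X.
Proof.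
move=> ij mX _ B mB; have := mX measurableT B mB.
by rewrite !(measurable_g_sigma_algebra (filtration_sigma _)); exact: filtration_le.
Qed.

Variables (A : nat -> set T) (X e : nat -> T -> R).
Hypotheses (HA : forall k, H k (A k)) (mX : forall k, measurable_wrt (H k.+1) (X k))
  (me : forall k, measurable_wrt (H k) (e k)).

Local Notation M lambda := (stopped_sum lambda A (fun k w => X k w - e k w)).

Lemma active_set_measurable (lambda : R) i : measurable_wrt (H i) (M lambda i) ->
  H i (A i `&` [set v | M lambda i v < lambda]).
Proof.
move=> mS; rewrite -(measurable_g_sigma_algebra (filtration_sigma i)).
apply: measurableI; first by rewrite (measurable_g_sigma_algebra (filtration_sigma i)).
rewrite -[X in measurable X]setTI.
rewrite (_ : [set v | _] = M lambda i @^-1` `]-oo, lambda[%classic).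
  by apply: mS => //; exact: measurable_itv.
by apply/seteqP; split => v /=; rewrite in_itv.
Qed.

Lemma stopped_sum_measurable (lambda : R) i : measurable_wrt (H i) (M lambda i).
Proof.
elim: i => [|i IH] /=; first exact: measurable_cst.
apply: measurable_funD; first exact: measurable_wrt_le (leqnSn i) IH.
apply: measurable_funM; last first.
  by apply: measurable_funB; [exact: mX|exact: measurable_wrt_le (leqnSn i) (@me i)].
apply: measurable_indic; rewrite (measurable_g_sigma_algebra (filtration_sigma _)).
exact: filtration_le (leqnSn i) _ (active_set_measurable IH).
Qed.

Lemma stopped_sum_measurableT (lambda : R) i : measurable_fun setT (M lambda i).
Proof.
apply: (measurable_wrt_sub (filtration_sigma i)); first exact: filtration_measurable.
exact: stopped_sum_measurable.
Qed.

Lemma tail_event_measurable (lambda : R) i :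
  measurable [set w | lambda <= M lambda i w].
Proof.
rewrite -[X in measurable X]setTI.
rewrite (_ : [set w | _] = M lambda i @^-1` `[lambda, +oo[%classic); last first.
  by apply/seteqP; split => w /=; rewrite in_itv /= andbT.
by apply: stopped_sum_measurableT => //; exact: measurable_itv.
Qed.

Variables (Zp Zn Z2 : nat -> T -> \bar R) (beta b : R) (N : nat).
Hypotheses (beta0 : 0 < beta) (b0 : 0 < b)
  (hZp : forall k, is_cond_exp_nneg P (H k) (EFin \o X k)^\+%E (Zp k))
  (hZn : forall k, is_cond_exp_nneg P (H k) (EFin \o X k)^\-%E (Zn k))
  (hZ2 : forall k, is_cond_exp_nneg P (H k) (EFin \o (fun w => X k w ^+ 2)) (Z2 k))
  (ebeta : forall k w, `|e k w| <= beta)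
  (Xbeta : forall k, (k < N)%N -> {ae P, forall w, A k w -> `|X k w| <= beta})
  (Zpn : forall k, (k < N)%N -> {ae P, forall w, A k w -> Zp k w = ((e k w)%:E + Zn k w)%E})
  (Z2b : forall k, (k < N)%N -> {ae P, forall w, A k w -> (Z2 k w <= b%:E)%E}).

(** At each step the space splits into the set where the sum is still moving,
    where [exp_moment_step] applies, and its complement, where it is constant. *)
Lemma stopped_sum_exp_moment lambda theta i : 0 <= theta -> theta * beta < 1 -> (i <= N)%N ->
  (\int[P]_w (expR (theta * M lambda i w))%:E <=
   (expR (i%:R * (theta ^+ 2 * b / (2 * (1 - theta * beta)))))%:E)%E.
Proof.
move=> th0 tb1; set C := theta ^+ 2 * b / _.
have C0 : 0 <= C by rewrite divr_ge0 ?mulr_ge0 ?sqr_ge0 ?(ltW b0) //; lra.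
have mS := stopped_sum_measurableT lambda.
have mES k : measurable_fun setT (fun w => (expR (theta * M lambda k w))%:E).
  by apply/measurable_EFinP; apply: measurableT_comp => //; apply: measurable_funM.
elim: i => [|i IH] iN.
  rewrite mul0r expR0 (eq_integral (cst 1%E)); last by move=> w _; rewrite /= mulr0 expR0.
  by rewrite integral_cst //= mul1e probability_le1.
have {}IH := IH (ltnW iN).
pose B : set T := A i `&` [set v | M lambda i v < lambda].
have HB : H i B by apply: active_set_measurable; exact: stopped_sum_measurable.
have mB := filtration_measurable HB.
have mBc : measurable (~` B) by exact: measurableC.
have split_int (f : T -> \bar R) : measurable_fun setT f -> (forall w, 0 <= f w)%E ->
    (\int[P]_w f w = \int[P]_(w in B) f w + \int[P]_(w in ~` B) f w)%E.
  move=> mf f0; rewrite -ge0_integral_setU // ?setUv //.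
  by apply/disj_setPS => w [].
rewrite split_int //.
apply: (@le_trans _ _ ((expR C)%:E * \int[P]_w (expR (theta * M lambda i w))%:E)%E); last first.
  rewrite -natr1 mulrDl mul1r addrC expRD EFinM.
  by apply: lee_wpmul2l => //; rewrite lee_fin expR_ge0.
rewrite (split_int (fun w => (expR (theta * M lambda i w))%:E)) //.
have int0 E : (0 <= \int[P]_(w in E) (expR (theta * M lambda i w))%:E)%E.
  by apply: integral_ge0 => w _; rewrite lee_fin expR_ge0.
rewrite ge0_muleDr //; apply: leeD.
  rewrite (@eq_integral _ _ _ P B
    (fun w => (expR (theta * M lambda i w) * expR (theta * (X i w - e i w)))%:E)); last first.
    by move=> w /[!inE] Bw; rewrite /= -/B indicE mem_set // mul1r mulrDr expRD.
  apply: (@exp_moment_step _ _ _ P _ (filtration_sigma i) (@filtration_measurable i)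
    (X i) (e i) (fun w => expR (theta * M lambda i w)) (Zp i) (Zn i) (Z2 i) beta b theta B) => //.
  - apply: (measurable_wrt_sub (filtration_sigma i.+1)); [exact: filtration_measurable | exact: mX].
  - apply: measurableT_comp => //; apply: measurable_funM => //.
      exact: stopped_sum_measurable.
  - by apply: filterS (Xbeta iN) => w h [/h].
  - by apply: filterS (Zpn iN) => w h [/h].
  - by apply: filterS (Z2b iN) => w h [/h].
  - apply: le_lt_trans (_ : (_ <= (expR (i%:R * C))%:E)%E) (ltry _).
    apply: le_trans IH; rewrite [leRHS]split_int //.
    by rewrite leeDl.
rewrite (@eq_integral _ _ _ P _ (fun w => (expR (theta * M lambda i w))%:E)).
  by rewrite lee_pemull // lee_fin; apply: le_trans (expR_ge1Dx C); rewrite lerDl.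
by move=> w /[!inE] nBw; rewrite /= -/B indicE memNset // mul0r addr0.
Qed.

(** Markov's inequality for [expR (theta * _)], with
    [theta = lambda / (v + 2 * beta * lambda)].  This choice gives
    [1 - theta * beta = (v + beta * lambda) / (v + 2 * beta * lambda)], so the
    second-order term [theta ^+ 2 * v / (2 * (1 - theta * beta))] eats up at most
    half of [theta * lambda = lambda ^+ 2 / (v + 2 * beta * lambda)]. *)
Lemma freedman_tail (lambda v : R) : 0 < lambda -> b * N%:R <= v ->
  (P [set w | (lambda <= M lambda N w)%R] <=
   (expR (- (lambda ^+ 2 / (2 * (v + 2 * beta * lambda)))))%:E)%E.
Proof.
move=> l0 bNv.
have bl : 0 < beta * lambda by rewrite mulr_gt0.
have v0 : 0 <= v by apply: le_trans bNv; rewrite mulr_ge0 // ltW.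
pose q := v + 2 * beta * lambda.
have q0 : 0 < q by rewrite /q; lra.
pose theta := lambda / q.
have th0 : 0 <= theta by rewrite divr_ge0 // ltW.
have e1 : 1 - theta * beta = (v + beta * lambda) / q.
  by rewrite /theta /q; field; rewrite -/q gt_eqF.
have tb1 : theta * beta < 1.
  by rewrite -subr_gt0 e1 divr_gt0 //; lra.
have mE := tail_event_measurable lambda N; have mS := stopped_sum_measurableT lambda N.
have := stopped_sum_exp_moment lambda th0 tb1 (leqnn N).
set C := theta ^+ 2 * b / _ => moment.
have NC : N%:R * C - theta * lambda <= - (lambda ^+ 2 / (2 * q)).
  have -> : N%:R * C = theta ^+ 2 * (b * N%:R) / (2 * (1 - theta * beta)) by rewrite /C; ring.
  have vb : 0 < v + beta * lambda by lra.
  apply: (@le_trans _ _ (theta ^+ 2 * v / (2 * (1 - theta * beta)) - theta * lambda)).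
    rewrite lerD2r ler_wpM2r ?invr_ge0 ?ler_wpM2l ?sqr_ge0 //; lra.
  rewrite e1 /theta.
  have -> : (lambda / q) ^+ 2 * v / (2 * ((v + beta * lambda) / q)) - lambda / q * lambda =
     - (lambda ^+ 2 / (2 * q)) * ((v + 2 * (beta * lambda)) / (v + beta * lambda)).
    by field; rewrite !gt_eqF.
  rewrite ger_nMr ?ler_pdivlMr ?oppr_lt0 ?divr_gt0 ?exprn_gt0 ?mulr_gt0 //; lra.
have lower : ((expR (theta * lambda))%:E * P [set w | (lambda <= M lambda N w)%R] <=
   \int[P]_w (expR (theta * M lambda N w))%:E)%E.
  have mf : measurable_fun setT (fun w => (expR (theta * M lambda N w))%:E).
    by apply/measurable_EFinP; apply: measurableT_comp => //; apply: measurable_funM.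
  rewrite -integral_cst //.
  apply: (@le_trans _ _ (\int[P]_(w in [set w | (lambda <= M lambda N w)%R])
    (expR (theta * M lambda N w))%:E)%E).
    apply: ge0_le_integral => //.
    - by move=> w _; rewrite lee_fin expR_ge0.
    - exact: measurable_funTS.
    - by move=> w /= lw; rewrite lee_fin ler_expR ler_wpM2l.
  by apply: ge0_subset_integral => // w _; rewrite lee_fin expR_ge0.
have := le_trans lower moment; rewrite muleC -lee_pdivlMr ?expR_gt0 // => /le_trans; apply.
by rewrite -EFinM lee_fin -expRN -expRD ler_expR.
Qed.

End freedman.

(** * Two-sided deviations with given versions of the conditional moments *)

Section tail.
Context d (T : measurableType d) (R : realType) (P : probability T R).

(** Truncation turns a version of a conditional expectation, which may be
    infinite on a null set or outside the set of interest, into a bounded real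
    function that is still measurable for the same sigma-algebra. *)
Definition clamp (beta x : R) : R := Num.max (- beta) (Num.min beta x).

Lemma clamp_le beta x : 0 <= beta -> `|clamp beta x| <= beta.
Proof.
by move=> b0; rewrite ler_norml /clamp le_max lexx ge_max ge_min lexx /= andbT; lra.
Qed.

Lemma clamp_id beta x : `|x| <= beta -> clamp beta x = x.
Proof.
by rewrite ler_norml /clamp => /andP[h1 h2]; rewrite min_r // max_r.
Qed.

Lemma measurable_clamp (G : set (set T)) beta (Z : T -> \bar R) :
  measurable_wrt G Z -> measurable_wrt G (fun w => clamp beta (fine (Z w))).
Proof.
move=> mZ; apply: measurable_maxr; first exact: measurable_cst.
apply: measurable_minr; first exact: measurable_cst.
by apply: measurableT_comp mZ; exact: fine_measurable.
Qed.

Variable (G : set (set T)).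
Hypotheses (sG : sigma_algebra setT G) (GM : G `<=` measurable).

(** Where [X] is bounded by [beta], so are both parts of its conditional
    expectation; there is no [+oo - +oo] and the truncation is the identity. *)
Lemma cond_exp_bounded (X : T -> R) (Z : T -> \bar R) (beta : R) (A : set T) :
  is_cond_exp P G X Z -> measurable_fun setT X -> 0 <= beta -> G A ->
  {ae P, forall w, A w -> `|X w| <= beta} ->
  exists Zp Zn : T -> \bar R,
    [/\ is_cond_exp_nneg P G (EFin \o X)^\+%E Zp,
        is_cond_exp_nneg P G (EFin \o X)^\-%E Zn &
        {ae P, forall w, A w -> let e := clamp beta (fine (Z w)) in
           [/\ Z w = e%:E, Zp w = (e%:E + Zn w)%E & Zn w = ((- e)%:E + Zp w)%E]}].
Proof.
move=> [mZ [Zp [Zn [hp hn ZE]]]] mX b0 GA Xb; exists Zp, Zn; split=> //.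
have mXp : measurable_fun setT (EFin \o X)^\+%E by apply/measurable_funepos/measurable_EFinP.
have mXn : measurable_fun setT (EFin \o X)^\-%E by apply/measurable_funeneg/measurable_EFinP.
have Xp_le : {ae P, forall w, A w -> ((EFin \o X)^\+ w <= beta%:E)%E}.
  apply: filterS Xb => w h Aw; have := h Aw.
  by rewrite funeposE /= ge_max !lee_fin ler_norml b0 => /andP[_ ->].
have Xn_le : {ae P, forall w, A w -> ((EFin \o X)^\- w <= beta%:E)%E}.
  apply: filterS Xb => w h Aw; have := h Aw.
  by rewrite funenegE /= ge_max !lee_fin ler_norml b0 lerNl => /andP[-> _].
have Zp_le := cond_exp_nneg_le sG GM hp mXp (funepos_ge0 _) b0 GA Xp_le.
have Zn_le := cond_exp_nneg_le sG GM hn mXn (funeneg_ge0 _) b0 GA Xn_le.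
have [Zp0 _ _] := hp; have [Zn0 _ _] := hn.
apply: filterS3 ZE Zp_le Zn_le => w + h1 h2 Aw.
move: (Zp0 w) (Zn0 w) (h1 Aw) (h2 Aw).
case: (Zp w) => // p; case: (Zn w) => // q; rewrite !lee_fin => p0 q0 pb qb ->.
have -> : clamp beta (fine (p%:E - q%:E)) = p - q.
  by rewrite clamp_id //= ler_norml; lra.
by split; rewrite -?EFinD //; congr EFin; ring.
Qed.

Lemma cond_exp_sqr (X : T -> R) (Z : T -> \bar R) :
  is_cond_exp P G (fun w => X w ^+ 2) Z ->
  exists2 Z2 : T -> \bar R, is_cond_exp_nneg P G (EFin \o (fun w => X w ^+ 2)) Z2 &
    {ae P, forall w, Z w = Z2 w}.
Proof.
move=> [mZ [Zp [Zn [hp hn ZE]]]].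
have Ep : (EFin \o (fun w => X w ^+ 2)%R)^\+%E = EFin \o (fun w => X w ^+ 2).
  by apply/funext => w; rewrite funeposE /= max_l // lee_fin sqr_ge0.
have En : (EFin \o (fun w => X w ^+ 2)%R)^\-%E = cst 0%E.
  by apply/funext => w; rewrite funenegE /= max_r // lee_fin oppr_le0 sqr_ge0.
rewrite Ep in hp; rewrite En in hn; exists Zp => //.
have GT : G setT.
  rewrite -(measurable_g_sigma_algebra sG).
  exact: (@measurableT _ (g_sigma_algebraType G)).
have Zn_le : {ae P, forall w, setT w -> (Zn w <= 0%:E)%E}.
  by apply: (cond_exp_nneg_le sG GM hn) => //; apply/aeW.
have [Zn0 _ _] := hn.
apply: filterS2 ZE Zn_le => w -> h.
have -> : Zn w = 0%E by apply/eqP; rewrite eq_le Zn0 h.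
by rewrite sube0.
Qed.

End tail.

Section two_sided.
Context d (T : measurableType d) (R : realType) (P : probability T R).
Variable (H : nat -> set (set T)).
Hypothesis hH : filtration H.
Variables (A : nat -> set T) (X : nat -> T -> R) (E1 E2 : nat -> T -> \bar R).
Variables (beta b lambda v : R) (N : nat).
Hypotheses (HA : forall k, H k (A k)) (mX : forall k, measurable_wrt (H k.+1) (X k))
  (beta0 : 0 < beta) (b0 : 0 < b) (lambda0 : 0 < lambda) (bNv : b * N%:R <= v)
  (hE1 : forall k, is_cond_exp P (H k) (X k) (E1 k))
  (hE2 : forall k, is_cond_exp P (H k) (fun w => X k w ^+ 2) (E2 k))
  (Xbeta : forall k, (k < N)%N -> {ae P, forall w, A k w -> `|X k w| <= beta})
  (E2b : forall k, (k < N)%N -> {ae P, forall w, A k w -> (E2 k w <= b%:E)%E}).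

(** The lower tail is the upper tail of [- X], whose positive and negative parts
    are those of [X] exchanged.  The bad set is the event that one of the two
    frozen sums ends at or above [lambda]. *)
Lemma martingale_deviation : exists bad : set T,
  [/\ measurable bad,
    (P bad <= (2 * expR (- (lambda ^+ 2 / (2 * (v + 2 * beta * lambda)))))%:E)%E &
    forall w, ~ bad w -> forall i, (i <= N)%N -> (forall k, (k < i)%N -> A k w) ->
      `|\sum_(k < i) (X k w - clamp beta (fine (E1 k w)))| < lambda].
Proof.
have sH := filtration_sigma hH; have MH := @filtration_measurable _ _ _ hH.
have mXT k : measurable_fun setT (X k).
  by apply: measurable_wrt_sub (@mX k); [exact: sH|exact: MH].
have : forall k, exists ZZ : (T -> \bar R) * (T -> \bar R),
   [/\ is_cond_exp_nneg P (H k) (EFin \o X k)^\+%E ZZ.1,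
        is_cond_exp_nneg P (H k) (EFin \o X k)^\-%E ZZ.2 &
        (k < N)%N -> {ae P, forall w, A k w -> let e := clamp beta (fine (E1 k w)) in
           [/\ E1 k w = e%:E, ZZ.1 w = (e%:E + ZZ.2 w)%E & ZZ.2 w = ((- e)%:E + ZZ.1 w)%E]}].
  move=> k; have [kN|kN] := boolP (k < N)%N.
    have [Zp [Zn [h1 h2 h3]]] := cond_exp_bounded (sH k) (@MH k) (hE1 k) (mXT k) (ltW beta0)
      (@HA k) (Xbeta kN).
    by exists (Zp, Zn).
  by have [_ [Zp [Zn [h1 h2 _]]]] := hE1 k; exists (Zp, Zn).
move=> /choice[ZZ hZZ].
have : forall k, exists Z2 : T -> \bar R,
    is_cond_exp_nneg P (H k) (EFin \o (fun w => X k w ^+ 2)) Z2 /\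
    {ae P, forall w, E2 k w = Z2 w}.
  by move=> k; have [Z2 h1 h2] := cond_exp_sqr (sH k) (@MH k) (hE2 k); exists Z2.
move=> /choice[Z2 hZ2].
pose e k w := clamp beta (fine (E1 k w)).
have me k : measurable_wrt (H k) (e k) by apply: measurable_clamp; have [] := hE1 k.
have eb k w : `|e k w| <= beta by apply: clamp_le; exact: ltW.
have Z2b k : (k < N)%N -> {ae P, forall w, A k w -> (Z2 k w <= b%:E)%E}.
  by move=> kN; apply: filterS2 (hZ2 k).2 (E2b kN) => w ->.
have Zpn k : (k < N)%N -> {ae P, forall w, A k w -> (ZZ k).1 w = ((e k w)%:E + (ZZ k).2 w)%E}.
  by have [_ _ h] := hZZ k; move=> /h; apply: filterS => w {}h /h[].
have Znp k : (k < N)%N -> {ae P, forall w, A k w -> (ZZ k).2 w = ((- e k w)%:E + (ZZ k).1 w)%E}.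
  by have [_ _ h] := hZZ k; move=> /h; apply: filterS => w {}h /h[].
pose up := [set w | lambda <= stopped_sum lambda A (fun k w => X k w - e k w) N w].
pose dn := [set w | lambda <= stopped_sum lambda A (fun k w => - X k w - - e k w) N w].
have Pup : (P up <= (expR (- (lambda ^+ 2 / (2 * (v + 2 * beta * lambda)))))%:E)%E.
  apply: (freedman_tail hH HA mX me beta0 b0 _ _ (fun k => (hZ2 k).1) eb Xbeta Zpn Z2b) => //.
  - by move=> k; have [] := hZZ k.
  - by move=> k; have [] := hZZ k.
have Pdn : (P dn <= (expR (- (lambda ^+ 2 / (2 * (v + 2 * beta * lambda)))))%:E)%E.
  apply: (freedman_tail hH (X := fun k w => - X k w) (e := fun k w => - e k w) HA _ _ beta0 b0
    (Zp := fun k => (ZZ k).2) (Zn := fun k => (ZZ k).1) _ _ (Z2 := Z2) _ _ _ Znp Z2b) => //.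
  - by move=> k; apply: measurable_funN; exact: mX.
  - by move=> k; apply: measurable_funN; exact: me.
  - by move=> k; have [_ + _] := hZZ k; rewrite -funeposN.
  - by move=> k; have [+ _ _] := hZZ k; rewrite -funenegN.
  - move=> k; rewrite (_ : (fun w => (- X k w) ^+ 2) = (fun w => X k w ^+ 2)).
      exact: (hZ2 k).1.
    by apply/funext => w; rewrite sqrrN.
  - by move=> k w; rewrite normrN.
  - by move=> k /Xbeta; apply: filterS => w; rewrite normrN.
have mup : measurable up by apply: (tail_event_measurable hH HA mX me).
have mdn : measurable dn.
  apply: (tail_event_measurable hH HA (X := fun k w => - X k w) (e := fun k w => - e k w)).
    by move=> k; apply: measurable_funN; exact: mX.
  by move=> k; apply: measurable_funN; exact: me.
exists (up `|` dn); split; first exact: measurableU.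
  apply: le_trans (measureU2 _ mup mdn) _.
  by rewrite mulrDl mul1r EFinD leeD.
move=> w /not_orP[/negP nup /negP ndn] i iN Ai; rewrite -ltNge in nup; rewrite -ltNge in ndn.
have h1 := stopped_sum_lt nup iN Ai; have h2 := stopped_sum_lt ndn iN Ai.
rewrite ltr_norml h1 andbT ltrNl -sumrN; move: h2; rewrite -/e.
by under eq_bigr do rewrite -opprD.
Qed.

End two_sided.

(** * Stopping times and the final estimate *)

Section alive.
Context d (T : measurableType d) (R : realType) (P : probability T R).

Definition before (tau : T -> option nat) (k : nat) : set T :=
  [set w | ((k%:R)%:E < time_val R (tau w))%E].

(** Whether the process is still running at time [k] is decided by the events
    [tau = i] with [i <= k], all of them in [H k]. *)
Lemma before_measurable (H : nat -> set (set T)) tau k :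
  filtration H -> stopping_time H tau -> H k (before tau k).
Proof.
move=> hH htau.
have -> : before tau k = \bigcap_(i in `I_k.+1) ~` [set w | tau w = Some i].
  apply/seteqP; split => w; rewrite /before /=.
    by move=> kt i /=; rewrite ltnS => ik ti; move: kt; rewrite ti /= lte_fin ltr_nat ltnNge ik.
  case E : (tau w) => [m|] h; last by rewrite ltry.
  rewrite /= lte_fin ltr_nat ltnNge; apply/negP => mk.
  by apply: (h m).
rewrite -(measurable_g_sigma_algebra (filtration_sigma hH k)).
apply: bigcap_measurableType => i /=; rewrite ltnS => ik; apply: measurableC.
rewrite (measurable_g_sigma_algebra (filtration_sigma hH k)).
by apply: (filtration_le hH ik); exact: htau.
Qed.

Lemma reached_measurable (H : nat -> set (set T)) tau i :
  filtration H -> stopping_time H tau ->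
  measurable [set w | ((i%:R)%:E <= time_val R (tau w))%E].
Proof.
move=> hH htau; case: i => [|k].
  rewrite (_ : [set w | _] = setT) //; apply/seteqP; split=> // w _ /=.
  by case: (tau w) => [m|]; rewrite /= ?leey // lee_fin.
rewrite (_ : [set w | _] = before tau k).
  exact: (filtration_measurable hH) (before_measurable k hH htau).
apply/seteqP; split=> w; rewrite /before /=; case: (tau w) => [m|] /=;
  by rewrite ?lee_fin ?lte_fin ?ler_nat ?ltr_nat ?leey ?ltry.
Qed.

Lemma measurable_until (H : nat -> set (set T)) tau (s : R) (I : finType)
    (F : I -> nat -> set T) : filtration H -> stopping_time H tau ->
  (forall j i, measurable (F j i)) ->
  measurable [set w | forall j i,
    ((i%:R)%:E <= mine (time_val R (tau w)) s%:E)%E -> F j i w].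
Proof.
move=> hH htau mF.
rewrite (_ : [set w | _] = \bigcap_(j in [set: I]) \bigcap_i
    (~` [set w | ((i%:R)%:E <= mine (time_val R (tau w)) s%:E)%E] `|` F j i)); last first.
  apply/seteqP; split=> w gw.
    move=> j _ i _.
    have [it|it] := pselect ((i%:R)%:E <= mine (time_val R (tau w)) s%:E)%E; last by left.
    by right; exact: gw.
  by move=> j i it; case: (gw j Logic.I i Logic.I).
apply: fin_bigcap_measurable => // j _; apply: bigcapT_measurable => i.
apply: measurableU => //; apply: measurableC; case: (boolP (i%:R <= s)) => is_.
  rewrite (_ : [set w | _] = [set w | ((i%:R)%:E <= time_val R (tau w))%E]).
    exact: reached_measurable hH htau.
  by apply/seteqP; split=> w /=; rewrite le_min lee_fin is_ andbT.
rewrite (_ : [set w | _] = set0) //.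
by apply/seteqP; split=> w //=; rewrite le_min lee_fin (negbTE is_) andbF.
Qed.

Lemma union_bound (I : finType) (F : I -> set T) (x : R) :
  (forall i, measurable (F i)) -> (forall i, (P (F i) <= x%:E)%E) ->
  exists E : set T, [/\ measurable E, (P E <= (#|I|%:R * x)%:E)%E &
    forall i, F i `<=` E].
Proof.
move=> mF Fx; exists (\big[setU/set0]_i F i); split; first exact: bigsetU_measurable.
  have -> : (#|I|%:R * x)%:E = (\sum_(i : I) x%:E)%E.
    by rewrite sumEFin sumr_const mulr_natl.
  suff [] : measurable (\big[setU/set0]_i F i) /\
     (P (\big[setU/set0]_i F i) <= \sum_(i : I) x%:E)%E by [].
  elim/big_ind2 : _ => [|A y B z [mA Ay] [mB Bz]|i _].
  - by split=> //; rewrite measure0.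
  - split; first exact: measurableU.
    by apply: le_trans (measureU2 _ mA mB) _; exact: leeD.
  - by [].
by move=> i w Fw; rewrite (bigD1 i) //=; left.
Qed.

End alive.

Theorem theorem10 (R : realType) (a : nat)
  (D : set (R * 'rV[R]_a)) (hD : domain D) (hDb : bounded_set D)
  (f : 'I_a -> R * 'rV[R]_a -> R) (L B : R) (hL : 0 < L)
  (hLip : forall j, L.-lipschitz_D (f j))
  (hB : forall j z, D z -> `|f j z| <= B)
  (ytilde : 'I_a -> R) (hy0D : D (0, \row_j ytilde j))
  (y : 'I_a -> R -> R) (sigma : R) (hsigma : 0 < sigma)
  (hode : ode_solution D f y sigma)
  (hy0 : forall j, y j 0 = ytilde j)
  (d : measure_display) (T : measurableType d) (P : probability T R)
  (H : nat -> set (set T)) (hH : filtration H)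
  (Y : 'I_a -> nat -> {RV P >-> R})
  (hY : forall j, adapted H (fun i => Y j i))
  (n : nat) (hn : (0 < n)%N)
  (beta b lambda delta : R)
  (hbeta : 0 < beta) (hb : 0 < b) (hlambda : 0 < lambda) (hdelta : 0 < delta)
  (hlarge : (L + B * L + delta * n%:R) / (3 * L) <= lambda)
  (hdist : forall t : R, 0 <= t < sigma ->
     forall z : R * 'rV[R]_a, boundary D z ->
     3 * lambda * expR (2 * L * t) / n%:R <= `|(t, \row_j y j t) - z|)
  (tau : T -> option nat) (htau : stopping_time H tau)
  (* versions of E[Delta Y_j(i) | H_i] and E[(Delta Y_j(i))^2 | H_i] *)
  (E1 E2 : 'I_a -> nat -> T -> \bar R)
  (hE1 : forall j i,
     is_cond_exp P (H i) (increment (fun k => Y j k) i) (E1 j i))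
  (hE2 : forall j i,
     is_cond_exp P (H i) (fun w => increment (fun k => Y j k) i w ^+ 2) (E2 j i))
  (hbounded : {ae P, forall w, forall i : nat,
     ((i%:R)%:E < mine (time_val R (tau w)) (sigma * n%:R)%:E)%E ->
     forall j, `|increment (fun k => Y j k) i w| <= beta /\
               (E2 j i w <= b%:E)%E})
  (htrend : {ae P, forall w, forall i : nat,
     ((i%:R)%:E < mine (time_val R (tau w)) (sigma * n%:R)%:E)%E ->
     D (i%:R / n%:R, \row_k (Y k i w / n%:R)) ->
     forall j,
       (`|E1 j i w - (f j (i%:R / n%:R, \row_k (Y k i w / n%:R))%R)%:E|
          <= delta%:E)%E})
  (hinit : {ae P, forall w, forall j,
     `|Y j 0%N w - y j 0 * n%:R| <= lambda}) :
  ((1 - 2 * a%:R *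
      expR (- (lambda ^+ 2 / (2 * (b * sigma * n%:R + 2 * beta * lambda)))))%:E
    <= P [set w | forall (j : 'I_a) (i : nat),
            ((i%:R)%:E <= mine (time_val R (tau w)) (sigma * n%:R)%:E)%E ->
            (`|Y j i w - n%:R * y j (i%:R / n%:R)|
              <= 3 * lambda * expR (2 * L * i%:R / n%:R))%R])%E.
Proof.
set good := [set w | _]; set p := expR _.
have sn0 : 0 <= sigma * n%:R by rewrite mulr_ge0 // ltW.
(* [N] is the integer part of [sigma * n]; with only [N] steps the accumulated
   variance [b * N] does not exceed [b * sigma * n] *)
pose N := Num.trunc (sigma * n%:R).
have Nsn : N%:R <= sigma * n%:R by rewrite truncn_le.
have leN i : (i%:R <= sigma * n%:R) = (i <= N)%N by rewrite truncn_ge_nat.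
pose A := before R tau.
have HA k : H k (A k) by exact: before_measurable.
have MH := @filtration_measurable _ _ _ hH.
have active w k : (k < N)%N -> A k w ->
    ((k%:R)%:E < mine (time_val R (tau w)) (sigma * n%:R)%:E)%E.
  by move=> kN Ak; rewrite lt_min Ak lte_fin; apply: lt_le_trans Nsn; rewrite ltr_nat.
pose X j k := increment (fun k => Y j k) k.
have mX j k : measurable_wrt (H k.+1) (X j k).
  apply: measurable_funB; first exact: hY.
  by apply: (measurable_wrt_le hH (leqnSn k)); exact: hY.
have Xb j k : (k < N)%N -> {ae P, forall w, A k w -> `|X j k w| <= beta}.
  by move=> kN; apply: filterS hbounded => w h Ak; have [] := h k (active _ _ kN Ak) j.
have Eb j k : (k < N)%N -> {ae P, forall w, A k w -> (E2 j k w <= b%:E)%E}.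
  by move=> kN; apply: filterS hbounded => w h Ak; have [] := h k (active _ _ kN Ak) j.
have bNv : b * N%:R <= b * sigma * n%:R by rewrite -mulrA ler_wpM2l // ltW.
have /choice[bad hbad] := fun j => martingale_deviation hH HA (@mX j) hbeta hb hlambda bNv
  (hE1 j) (hE2 j) (Xb j) (Eb j).
pose e j k w := clamp beta (fine (E1 j k w)).
have E1e : {ae P, forall w j k, (k < N)%N -> A k w -> E1 j k w = (e j k w)%:E}.
  apply: filter_forall => j; apply: ae_foralln => k.
  have [kN|kN] := boolP (k < N)%N; last exact: aeW.
  have mXT : measurable_fun setT (X j k).
    by apply: measurable_wrt_sub (@mX j k); [exact: filtration_sigma|exact: MH].
  have [Zp [Zn [_ _ h]]] := cond_exp_bounded (filtration_sigma hH k) (@MH k) (hE1 j k) mXT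
    (ltW hbeta) (@HA k) (Xb j k kN).
  by apply: filterS h => w {}h _ /h[].
have [Z [mZ PZ hZ]] : {ae P, forall w,
   (forall j, `|Y j 0%N w - y j 0 * n%:R| <= lambda) /\
   (forall k, (k < N)%N -> A k w -> D (k%:R / n%:R, \row_j (Y j k w / n%:R)) ->
      forall j, `|e j k w - f j (k%:R / n%:R, \row_k0 (Y k0 k w / n%:R))| <= delta)}.
  apply: filterS3 hinit htrend E1e => w h1 h2 h3; split=> // k kN Ak Dk j.
  by have := h2 k (active _ _ kN Ak) Dk j; rewrite h3 // -EFinB abse_EFin lee_fin.
have [U [mU PU badU]] := union_bound (fun j => let: And3 m _ _ := hbad j in m)
  (fun j => let: And3 _ p _ := hbad j in p).
have bad_sub : ~` good `<=` Z `|` U.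
  move=> w ngood; apply: contrapT => /not_orP[nZ nbad]; apply: ngood => j i.
  rewrite le_min lee_fin leN => /andP[it iN]; apply: ltW.
  have /contrapT[init trend] : ~ ~ _ := fun h => nZ (hZ w h).
  have Ak k : (k < i)%N -> A k w.
    by move=> ki; rewrite /A /before /=; apply: lt_le_trans it; rewrite lte_fin ltr_nat.
  have [_ oD _] := hD.
  apply: (euler_path_close_to_ode hL hLip hB hode oD hn hlambda hlarge hdist
    (Y := fun j k => Y j k w) (e := fun j k => e j k w) (N := i)) => //.
  - by rewrite leN.
  - move=> k ki Dk l; apply: trend => //; [exact: leq_trans iN|exact: Ak].
  - move=> m l mi; have [_ _ hl] := hbad l.
    apply: hl => //; [|exact: leq_trans iN|by move=> k km; apply: Ak; exact: leq_trans mi].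
    by move=> bl; apply: nbad; exact: badU bl.
have mgood : measurable good.
  apply: (measurable_until (sigma * n%:R) hH htau (F := fun j i =>
    [set w | `|Y j i w - n%:R * y j (i%:R / n%:R)| <= 3 * lambda * expR (2 * L * i%:R / n%:R)])).
  move=> j i.
  have mg : measurable_fun setT (fun w => `|Y j i w - n%:R * y j (i%:R / n%:R)|).
    by apply: measurableT_comp => //; apply: measurable_funB.
  rewrite -[X in measurable X]setTI.
  rewrite (_ : [set w | _] = (fun w => `|Y j i w - n%:R * y j (i%:R / n%:R)|) @^-1`
     `]-oo, (3 * lambda * expR (2 * L * i%:R / n%:R))]%classic).
    by apply: mg => //; exact: measurable_itv.
  by apply/seteqP; split => w /=; rewrite in_itv.
have -> : 1 - 2 * a%:R * p = 1 - a%:R * (2 * p) by ring.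
have Pbad : (P (~` good) <= (a%:R * (2 * p))%:E)%E.
  apply: (@le_trans _ _ (P (Z `|` U))).
    by apply: le_measure => //; rewrite inE; [exact: measurableC|exact: measurableU].
  apply: le_trans (measureU2 _ mZ mU) _.
  apply: le_trans (leeD (_ : P Z <= 0)%E PU) _; first by rewrite -PZ.
  by rewrite add0e card_ord.
move: Pbad; rewrite probability_setC //.
have gfin : P good \is a fin_num by rewrite fin_num_measure.
rewrite -(fineK gfin) -EFinB !lee_fin; lra.
Qed.
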